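(* Let $G$ be a group and let $H$ be a subgroup of $G$ (not necessarily normal). Let $\psi$, $S$ and $\sim$ be the relation on $G$, the subset of $G$, and the relation on $G$ defined from $H$ in the context, and let $\operatorname{Nc}(H)$ be the normal closure of $H$ in $G$. Then $\sim$ is precisely the relation induced by the left cosets of $\operatorname{Nc}(H)$ in $G$; that is, for all $g_1,g_2\in G$, $g_1\sim g_2$ if and only if there exists $a\in G$ with $g_1,g_2\in a\operatorname{Nc}(H)$. Moreover, $S=\operatorname{Nc}(H)$.
   Context: Let $G$ be a group and $H\le G$ any subgroup. A (left) block induced by $H$ in $G$ is a subset of $G$ of the form $aHbH=\{ah_1bh_2 \mid h_1,h_2\in H\}$ with $a,b\in G$. The relation $\psi$ on $G$ is defined by: $a\,\psi\, b$ if there exist $x_1,y_1,x_2,y_2\in G$ such that $x_1y_1=a$, $x_2y_2=b$, $x_1H=x_2H$ and $y_1H=y_2H$. That is, $a\,\psi\, b$ when there exists a block $B$ induced by $H$ such that $a,b\in B$. Define subsets $S_n\subseteq G$ recursively by $S_0=H$ and, for every integer $n\ge 1$, $S_n=\{g\in G\mid g\,\psi\, s\text{ for some }s\in S_{n-1}\}$. Let $S=\bigcup_{n}S_n$. The relation $\sim$ on $G$ is defined by: $g_1\sim g_2$ when there exists some $a\in G$ such that $g_1,g_2\in aS$, where $aS=\{as\mid s\in S\}$. $\operatorname{Nc}(H)=\langle ghg^{-1}\mid g\in G,\ h\in H\rangle$ denotes the normal closure of $H$ in $G$. *)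

(* Defs.v *)
From mathcomp Require Import all_boot.
From mathcomp Require Import boolp classical_sets.

Set Implicit Arguments.
Unset Strict Implicit.
Unset Printing Implicit Defensive.

Local Open Scope classical_set_scope.
Local Open Scope group_scope.

Section Definitions.
Variable G : groupType.
Implicit Types (H A : set G) (a b g x y : G) (n : nat).

(* [group_closed] expects a boolean predicate; for a classical set, [mem A] is
   the one given by membership in [A]. *)
Definition subgroup A : Prop := group_closed (mem A).

Definition lcoset a A : set G := [set a * s | s in A].

Definition block H a b : set G :=
  [set g | exists h1 h2, [/\ H h1, H h2 & g = a * h1 * b * h2]].

Definition psi H a b : Prop :=
  exists x1 y1 x2 y2, [/\ x1 * y1 = a, x2 * y2 = b,
    lcoset x1 H = lcoset x2 H & lcoset y1 H = lcoset y2 H].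

Fixpoint psi_iter H n : set G :=
  if n is n'.+1 then [set g | exists2 s, psi_iter H n' s & psi H g s] else H.

Definition psi_closure H : set G := \bigcup_n psi_iter H n.

Definition sim H g1 g2 : Prop :=
  exists a, lcoset a (psi_closure H) g1 /\ lcoset a (psi_closure H) g2.

Definition generated A : set G := smallest subgroup A.

Definition normal_closure H : set G :=
  generated [set x | exists g h, H h /\ x = g * h * g^-1].

Lemma subgroupP A :
  subgroup A <-> A 1 /\ forall x y, A x -> A y -> A (x * y^-1).
Proof.
split=> -[A1 AB]; split.
- exact: set_mem.
- by move=> x y Ax Ay; apply/set_mem/AB; apply: mem_set.
- exact: mem_set.
- by move=> x y /set_mem Ax /set_mem Ay; apply/mem_set/AB.
Qed.

Lemma psi_blockP H a b : subgroup H ->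
  psi H a b <-> exists x y, block H x y a /\ block H x y b.
Proof.
move=> /subgroupP[H1 HB].
have HV x : H x -> H x^-1 by move=> Hx; rewrite -[_^-1]mul1g; apply: HB.
have HM x y : H x -> H y -> H (x * y).
  by move=> Hx Hy; rewrite -[y]invgK; apply: HB => //; apply: HV.
have lcosetM x h : H h -> lcoset (x * h) H = lcoset x H.
  move=> Hh; apply/seteqP; split=> _ [k Hk <-].
    by exists (h * k); [apply: HM | rewrite mulgA].
  by exists (h^-1 * k); [apply: HM => //; apply: HV | rewrite mulgA mulgK].
split=> [[x1 [y1 [x2 [y2 [<- <- ex ey]]]]]|].
  have lcoset1 x : lcoset x H x by exists 1; rewrite ?mulg1.
  have [h Hh <-] : lcoset x1 H x2 by rewrite ex.
  have [k Hk <-] : lcoset y1 H y2 by rewrite ey.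
  exists x1, y1; split.
    by exists 1, 1; rewrite !mulg1.
  by exists h, k; rewrite !mulgA.
move=> [x [y [[h1 [h2 [Hh1 Hh2 ->]]] [k1 [k2 [Hk1 Hk2 ->]]]]]].
exists (x * h1), (y * h2), (x * k1), (y * k2).
by rewrite !lcosetM // !mulgA.
Qed.

End Definitions.

(* Main.v *)
Require Import Defs.
From mathcomp Require Import all_boot.
From mathcomp Require Import boolp classical_sets.

(** Two elements lie in a common block exactly when one arises from the other
by multiplying on the left by a conjugate of an element of [H] and on the right
by an element of [H] ([psi_conjP]).  Both factors lie in the normal closure, so
the iterates of [psi] starting from [H] never leave it
([psi_closure_sub_normal_closure]).  Conversely, left multiplication by a
conjugate of an element of [H] moves each iterate into the next one, so the
union [S] of the iterates is stable under every such multiplication.  The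
elements that stabilise [S] by left translation form a subgroup; it contains
the conjugates of [H], hence the whole normal closure, and applying it to the
identity, which lies in [S], puts the normal closure inside [S]
([normal_closure_sub_psi_closure]).  Once [S] is the normal closure, [sim] is
by definition the relation of lying in a common left coset of it. *)

Set Implicit Arguments.
Unset Strict Implicit.
Unset Printing Implicit Defensive.

Local Open Scope classical_set_scope.
Local Open Scope group_scope.

Section SubgroupTheory.
Variable G : groupType.
Implicit Types (A : set G) (x y : G).

Lemma subgroup1 A : subgroup A -> A 1.
Proof. by move=> /subgroupP[]. Qed.

Lemma subgroupV A x : subgroup A -> A x -> A x^-1.
Proof.
by move=> /subgroupP[A1 AB] Ax; rewrite -[x^-1]mul1g; apply: AB.
Qed.

Lemma subgroupM A x y : subgroup A -> A x -> A y -> A (x * y).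
Proof.
move=> sA Ax Ay; rewrite -[y]invgK.
by case/subgroupP: (sA) => _; apply=> //; apply: subgroupV.
Qed.

Lemma generated_subgroup A : subgroup (generated A).
Proof.
apply/subgroupP; split=> [B [/subgroup1]//|x y Ax Ay B [sB AB]].
apply: subgroupM => //; first exact: Ax.
by apply: subgroupV => //; apply: Ay.
Qed.

Lemma left_stabilizer_subgroup A : subgroup [set c | forall x, A x <-> A (c * x)].
Proof.
apply/subgroupP; split=> [x|c d Ac Ad x] /=; first by rewrite mul1g.
rewrite -mulgA -Ac.
by have := Ad (d^-1 * x); rewrite mulVKg => ->.
Qed.

End SubgroupTheory.

Section PsiClosure.
Variables (G : groupType) (H : set G).
Hypothesis sH : subgroup H.
Implicit Types (a b g h k : G).

(** Inside the block [xHyH], the elements [x * h1 * y * h2] and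
[x * k1 * y * k2] differ on the left by [h1 * k1^-1] conjugated by [x] and on
the right by [k2^-1 * h2].  Conversely the block [gHg^-1bH] contains both [b]
and each product of the given form. *)
Lemma psi_conjP a b :
  psi H a b <-> exists g h k, [/\ H h, H k & a = g * h * g^-1 * b * k].
Proof.
split=> [/(psi_blockP _ _ sH)|[g [h [k [Hh Hk ->]]]]].
  move=> [x [y [[h1 [h2 [Hh1 Hh2 ->]]] [k1 [k2 [Hk1 Hk2 ->]]]]]].
  exists x, (h1 * k1^-1), (k2^-1 * h2).
  split; [by apply: subgroupM => //; apply: subgroupV .. |].
  by rewrite !mulgA mulgK !mulgVK.
apply/(psi_blockP _ _ sH); exists g, (g^-1 * b); split.
  by exists h, k; rewrite !mulgA.
by exists 1, 1; split; [exact: subgroup1 .. | rewrite !mulg1 mulVKg].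
Qed.

Lemma conj_normal_closure g h : H h -> normal_closure H (g * h * g^-1).
Proof. by move=> Hh; apply: sub_gen_smallest; exists g, h. Qed.

Lemma sub_normal_closure : H `<=` normal_closure H.
Proof.
by move=> h /(conj_normal_closure 1); rewrite mul1g invg1 mulg1.
Qed.

Lemma psi_closure_sub_normal_closure : psi_closure H `<=` normal_closure H.
Proof.
have sN : subgroup (normal_closure H) by exact: generated_subgroup.
move=> g [n _]; elim: n g => [|n IHn] g /=; first exact: sub_normal_closure.
move=> [s /IHn Ns /psi_conjP[x [h [k [Hh Hk ->]]]]].
apply: subgroupM (sub_normal_closure Hk) => //.
exact: subgroupM (conj_normal_closure _ Hh) Ns.
Qed.

Lemma psi_closure_conjM g h s :
  H h -> psi_closure H s -> psi_closure H (g * h * g^-1 * s).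
Proof.
move=> Hh [n _ Sns]; exists n.+1 => //; exists s => //.
apply/psi_conjP; exists g, h, 1.
by split; [| exact: subgroup1 | rewrite mulg1].
Qed.

(** [psi_closure H] is not visibly closed under products, so the minimality of
the normal closure is applied to its left stabiliser instead, which is always a
subgroup. *)
Lemma normal_closure_sub_psi_closure : normal_closure H `<=` psi_closure H.
Proof.
have N_stab : normal_closure H `<=`
    [set c | forall s, psi_closure H s <-> psi_closure H (c * s)].
  apply: smallest_sub; first exact: left_stabilizer_subgroup.
  move=> _ [g [h [Hh ->]]] s; split; first exact: psi_closure_conjM.
  (* The inverse of a conjugate of [h] is the conjugate of [h^-1]. *)
  move/(psi_closure_conjM g (subgroupV sH Hh)).
  by rewrite !mulgA mulgVK mulgVK mulgV mul1g.
move=> c /N_stab/(_ 1)[+ _]; rewrite mulg1; apply.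
by exists 0%N => //; apply: subgroup1.
Qed.

End PsiClosure.

Theorem theorem1 (G : groupType) (H : set G) (hH : subgroup H) :
  (forall g1 g2 : G,
     sim H g1 g2 <->
     exists a : G, lcoset a (normal_closure H) g1 /\
                   lcoset a (normal_closure H) g2) /\
  psi_closure H = normal_closure H.
Proof.
have SN : psi_closure H = normal_closure H.
  apply/seteqP; split; first exact: psi_closure_sub_normal_closure.
  exact: normal_closure_sub_psi_closure.
by split=> // g1 g2; rewrite /sim SN.
Qed.
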